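(* A sequence of non-negative integers $a_1 a_2 \cdots$ is the $(-\beta)$-expansion of $\frac{-\beta}{\beta+1}$ for some (unique) real $\beta > 1$ if and only if it satisfies all of the following four conditions: (1) $a_k a_{k+1} \cdots \le_{\mathrm{alt}} a_1 a_2 \cdots$ for all $k \ge 2$; (2) $a_1 a_2 \cdots >_{\mathrm{alt}} u_1 u_2 \cdots$; (3) $a_1 a_2 \cdots \notin \{a_1 \cdots a_k,\ a_1 \cdots a_{k-1} (a_k-1)\, 0\}^\omega \setminus \{\overline{a_1 \cdots a_k}\}$ for all $k \ge 1$ with $\overline{a_1 \cdots a_k} >_{\mathrm{alt}} u_1 u_2 \cdots$; (4) $a_1 a_2 \cdots \notin \{a_1 \cdots a_k\, 0,\ a_1 \cdots a_{k-1} (a_k+1)\}^\omega$ for all $k \ge 1$ with $\overline{a_1 \cdots a_{k-1} (a_k+1)} >_{\mathrm{alt}} u_1 u_2 \cdots$.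
   Context: For real $\beta > 1$, the $(-\beta)$-transformation is $$T_{-\beta}:\ \left[\tfrac{-\beta}{\beta+1}, \tfrac{1}{\beta+1}\right) \to \left[\tfrac{-\beta}{\beta+1}, \tfrac{1}{\beta+1}\right),\quad x \mapsto -\beta x - \left\lfloor \tfrac{\beta}{\beta+1} - \beta x \right\rfloor,$$ and the $(-\beta)$-expansion of $x \in \left[\frac{-\beta}{\beta+1}, \frac{1}{\beta+1}\right)$ is the digit sequence $\varepsilon_1(x)\varepsilon_2(x)\cdots$ with $\varepsilon_n(x) = \left\lfloor \tfrac{\beta}{\beta+1} - \beta\, T_{-\beta}^{n-1}(x) \right\rfloor$; it satisfies $x = \sum_{n\ge 1} \varepsilon_n(x)/(-\beta)^n$. The alternating lexicographic order on infinite sequences of integers is defined as follows: if $x_1 \cdots x_{k-1} = y_1 \cdots y_{k-1}$ and $x_k \ne y_k$, then $x_1 x_2 \cdots <_{\mathrm{alt}} y_1 y_2 \cdots$ if and only if $x_k < y_k$ when $k$ is odd, and $y_k < x_k$ when $k$ is even. As usual, $\le_{\mathrm{alt}}$ means $<_{\mathrm{alt}}$ or equal, and $>_{\mathrm{alt}}$ is the reverse of $<_{\mathrm{alt}}$. Let $\varphi$ be the morphism of words on the alphabet $\{0,1\}$ (i.e. compatible with concatenation) defined by $\varphi(1) = 100$, $\varphi(0) = 1$. The sequence $u_1 u_2 \cdots = 100111001001001110011\cdots$ is the infinite sequence that starts with $\varphi^n(1)$ for all $n \ge 0$. For finite words $v, w$ of integers, $\{v, w\}^\omega$ denotes the set of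 all infinite sequences obtained by concatenating infinitely many blocks each equal to $v$ or $w$, and $\overline{v} = vvv\cdots$ denotes the periodic sequence with period $v$. In $a_1 \cdots a_{k-1}(a_k \pm 1)$, the last letter is the integer $a_k \pm 1$; for $k = 1$ the word $a_1\cdots a_{k-1}$ is empty. *)

(* Defs.v *)
From mathcomp Require Import all_boot all_order all_algebra.
From mathcomp Require Import classical_sets reals.
From mathcomp Require Import lra.

Set Implicit Arguments.
Unset Strict Implicit.
Unset Printing Implicit Defensive.

Import Order.TTheory GRing.Theory Num.Theory.

Local Open Scope ring_scope.

(* The sequence x_1 x_2 ... is encoded by x : nat -> int with x_k = x k.-1, so
   the word x_1 ... x_k is mkseq x k. *)
Definition zseq := nat -> int.
Definition word := seq int.

Section MinusBetaExpansion.
Variable R : realType.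
Implicit Types beta x : R.

(* Extended to all of R by the same formula; Tneg_itv shows that it restricts
   to a self-map of [- beta / (beta + 1), 1 / (beta + 1)). *)
Definition Tneg beta x : R :=
  - beta * x - (Num.floor (beta / (beta + 1) - beta * x))%:~R.

Lemma Tneg_itv beta x : 1 < beta ->
  - beta / (beta + 1) <= Tneg beta x < 1 / (beta + 1).
Proof.
move=> b1; rewrite /Tneg.
have /andP[fl fu] := floor_itv (beta / (beta + 1) - beta * x).
rewrite intrD in fu.
have e : beta / (beta + 1) + 1 / (beta + 1) = 1.
  by rewrite -mulrDl divff // gt_eqF // addr_gt0 // (lt_trans _ b1).
rewrite !mulNr; apply/andP; split; lra.
Qed.

Definition expansion beta x : zseq := fun n =>
  Num.floor (beta / (beta + 1) - beta * iter n (Tneg beta) x).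

End MinusBetaExpansion.

(* With indices starting at 0, the comparison is reversed at odd k. *)
Definition alt_lt (x y : zseq) : Prop :=
  exists k, [/\ forall i, (i < k)%N -> x i = y i, x k != y k &
    if odd k then y k < x k else x k < y k].

Definition alt_le (x y : zseq) : Prop := alt_lt x y \/ x = y.

(* Words over {0,1} are sequences of booleans, true standing for 1. *)
Definition phi (w : seq bool) : seq bool :=
  flatten [seq if b then [:: true; false; false] else [:: true] | b <- w].

Definition phi_iter (n : nat) : seq bool := iter n phi [:: true].

(* phi_iter n has more than n letters; see u_phi_iter. *)
Definition u : zseq := fun n => (nth false (phi_iter n) n : nat)%:Z.

Lemma phi_cat v w : phi (v ++ w) = phi v ++ phi w.
Proof. by rewrite /phi map_cat flatten_cat. Qed.

Lemma phi_iter_prefixS n : prefix (phi_iter n) (phi_iter n.+1).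
Proof.
elim: n => [//|n /prefixP[s e]].
change (prefix (phi (phi_iter n)) (phi (phi_iter n.+1))).
by rewrite e phi_cat prefix_prefix.
Qed.

Lemma phi_iter_prefix m n : (m <= n)%N -> prefix (phi_iter m) (phi_iter n).
Proof.
move=> /subnK <-; elim: (n - m)%N => [|d IH]; first exact: prefix_refl.
exact: prefix_trans IH (phi_iter_prefixS _).
Qed.

Lemma size_phi_iter n : (n < size (phi_iter n))%N.
Proof.
have size_phi w : (size w <= size (phi w))%N.
  elim: w => [//|b w IH]; rewrite -cat1s phi_cat !size_cat leq_add //.
  by case: b.
elim: n => [//|n IH]; apply: (leq_ltn_trans IH).
have /prefixP[s e] := phi_iter_prefix (leq0n n).
change (size (phi_iter n) < size (phi (phi_iter n)))%N.
by rewrite e phi_cat /= !ltnS (leq_trans (size_phi s)) // leqW.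
Qed.

Lemma u_phi_iter n i : (i < size (phi_iter n))%N ->
  u i = (nth false (phi_iter n) i : nat)%:Z.
Proof.
move=> lti; rewrite /u; congr (Posz (nat_of_bool _)).
have [/phi_iter_prefix|/ltnW /phi_iter_prefix] := leqP i n.
  by move=> /prefixP[s ->]; rewrite nth_cat size_phi_iter.
by move=> /prefixP[s ->]; rewrite nth_cat lti.
Qed.

Definition tail_from (a : zseq) (k : nat) : zseq :=
  fun n => a (k.-1 + n)%N.

Definition periodic (v : word) : zseq := fun n => nth 0 v (n %% size v).

(* For nonempty v and w, the set {v, w}^omega: every finite concatenation of
   the blocks b 0, b 1, ... is a prefix of x. *)
Definition omega2 (v w : word) : set zseq :=
  [set x | exists b : nat -> word, (forall i, b i = v \/ b i = w) /\
     forall n, let p := flatten (mkseq b n) in mkseq x (size p) = p].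

(* a_1 ... a_{k-1} (a_k + d), for k >= 1. *)
Definition change_last (a : zseq) (k : nat) (d : int) : word :=
  rcons (mkseq a k.-1) (a k.-1 + d).

(* Main.v *)
(* In the coordinate y = 1 / (b + 1) - x the transformation becomes
   y |-> floor (b y) + 1 - b y on (0, 1], and the expansion of the left end
   point becomes the itinerary kn b of 1; so a = kn b if and only if the orbit
   y_0 = 1, y_(n+1) = a_n + 1 - b y_n stays in (0, 1].

   - kn is strictly increasing for the alternating order. If b < g but
     kn g <= kn b, reading expansions of base g in base b is a monotone
     semiconjugacy th of the map of slope g to the map of slope b. Each step
     multiplies increments of th by b but lengths by g > b, so th would increase
     by more than any multiple of the length, although 0 <= th <= 1.
   - If b^k < 2, then kn b agrees with u on k letters: the block phi^m(1) acts
     on distances to 1 by D |-> b^p (c_m - D), with p the length of the block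
     and c_(m+1) = c_m (1 - b^-p). Hence kn b tends to u as b tends to 1, and
     u < kn b by monotonicity.
   - Under (1) and (2), the infimum b of the bases g with a <= kn g is > 1, and
     the orbit of 1 with digits a stays in the closed interval [0, 1]. If it
     reaches 0, consider its first visit to {0, 1}, and let v be the word that
     leads from 1 back to 1. Then a is a concatenation of v and of the detour
     through 0, which (3) and (4) exclude.
   - Conversely, if kn b is such a concatenation, the distances to 1 at the ends
     of the blocks grow geometrically when b^(|v|+1) > b + 1. Otherwise
     b^|v| < 2, kn b agrees with u on |v| letters, and vvv... <= u. *)
Require Import Defs.
From mathcomp Require Import all_boot all_order all_algebra.
From mathcomp Require Import boolp classical_sets reals.
From mathcomp Require Import ring lra zify.

Set Implicit Arguments.
Unset Strict Implicit.
Unset Printing Implicit Defensive.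

Import Order.TTheory GRing.Theory Num.Theory.

Local Open Scope ring_scope.
Local Open Scope classical_set_scope.

(** * The alternating order *)

Definition shift (k : nat) (a : zseq) : zseq := fun n => a (k + n)%N.

Lemma shiftD m n a : shift m (shift n a) = shift (n + m) a.
Proof. by apply/funext => i; rewrite /shift addnA. Qed.

Lemma alt_total (x y : zseq) : [\/ x = y, alt_lt x y | alt_lt y x].
Proof.
have [/funext->|/existsNP[n /eqP xyn]] := pselect (forall n, x n = y n).
  by constructor 1.
have [k xyk kmin] := ex_minnP (ex_intro (fun k => x k != y k) n xyn).
have eqxy i : (i < k)%N -> x i = y i.
  by move=> ik; apply/eqP/negPn/negP => /kmin; rewrite leqNgt ik.
have [lt|lt|e] := ltgtP (x k) (y k); last by rewrite e eqxx in xyk.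
- have [o|o] := boolP (odd k); [constructor 3|constructor 2]; exists k.
    by split; rewrite 1?eq_sym ?o// => i /eqxy.
  by split; rewrite ?(negPf o).
- have [o|o] := boolP (odd k); [constructor 2|constructor 3]; exists k.
    by split; rewrite ?o.
  by split; rewrite 1?eq_sym ?(negPf o)// => i /eqxy.
Qed.

Lemma alt_ltxx x : ~ alt_lt x x.
Proof. by case=> k [_ /eqP]. Qed.

Lemma alt_lt_trans y x z : alt_lt x y -> alt_lt y z -> alt_lt x z.
Proof.
move=> [i [xyi nxy ixy]] [j [yzj nyz jyz]].
have [ij|ji|ij] := ltngtP i j.
- exists i; split; rewrite -?yzj// => m mi.
  by rewrite xyi // yzj // (ltn_trans mi).
- exists j; split; rewrite ?xyi// => m mj.
  by rewrite xyi ?yzj // (ltn_trans mj).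
- subst j; exists i; split=> [m mi||]; first by rewrite xyi ?yzj.
    move: ixy jyz; case: ifP => _ p q; apply/eqP => e;
    by move: p q; rewrite e => /lt_trans h /h; rewrite ltxx.
  by move: ixy jyz; case: ifP => _ p q; [apply: lt_trans p|apply: lt_trans q].
Qed.

Lemma alt_lt_asym x y : alt_lt x y -> ~ alt_lt y x.
Proof. by move=> xy /(alt_lt_trans xy)/alt_ltxx. Qed.

Lemma alt_le_lt_trans y x z : alt_le x y -> alt_lt y z -> alt_lt x z.
Proof. by case=> [/alt_lt_trans h /h|->]. Qed.

Lemma alt_le_trans y x z : alt_le x y -> alt_le y z -> alt_le x z.
Proof. by move=> xy [/(alt_le_lt_trans xy)|<- //]; left. Qed.

Lemma alt_leNgt x y : ~ alt_lt y x -> alt_le x y.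
Proof. by case: (alt_total x y) => [->|?|//] _; [right|left]. Qed.

Lemma alt_le0 x y : alt_le x y -> x 0%N <= y 0%N.
Proof.
case=> [[[|k] [xyk _ lt]]|->//]; first by rewrite ltW.
by rewrite xyk.
Qed.

(** * Orbits with prescribed digits *)

Section Orbits.
Variable R : realType.
Implicit Types (b x y : R) (s t w : zseq) (m n k : nat).

Fixpoint orb b t x n : R :=
  if n is m.+1 then (t m)%:~R + 1 - b * orb b t x m else x.

Lemma orbD b t x m n : orb b t x (m + n) = orb b (shift m t) (orb b t x m) n.
Proof. by elim: n => [|n IH]; rewrite ?addn0 // addnS /= IH. Qed.

Lemma eq_orb b s t x n : (forall i, (i < n)%N -> s i = t i) ->
  orb b s x n = orb b t x n.
Proof.
elim: n => //= n IH st; rewrite IH ?st // => i /ltnW; exact: st.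
Qed.

Lemma orb_sub b t x y n :
  orb b t y n - orb b t x n = (- b) ^+ n * (y - x).
Proof.
elim: n => [|n IH]; first by rewrite mul1r.
by rewrite exprS -mulrA -IH /=; ring.
Qed.

(* The first difference of two digit sequences cuts the interval between x
   and y into a piece ending at 0, a piece ending at 1 and m full copies of
   the unit interval. The same cut is valid in all bases. *)
Variant alt_cut_spec s t : Prop :=
| AltCutEven i m of ~~ odd i & (forall j, (j < i)%N -> s j = t j) &
    t i = s i + m%:Z + 1 &
    (forall b x y, b ^+ i.+1 * (y - x) =
       m%:R + orb b s x i.+1 + (1 - orb b t y i.+1))
| AltCutOdd i m of odd i & (forall j, (j < i)%N -> s j = t j) &
    s i = t i + m%:Z + 1 &
    (forall b x y, b ^+ i.+1 * (y - x) =
       m%:R + orb b t y i.+1 + (1 - orb b s x i.+1)).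

Lemma alt_cut s t : alt_lt s t -> alt_cut_spec s t.
Proof.
case=> i [st _].
have E b x y : orb b t y i.+1 - orb b s x i.+1 =
    (t i)%:~R - (s i)%:~R + (- b) ^+ i.+1 * (y - x).
  by rewrite exprS -mulrA -(orb_sub b t) /= (eq_orb _ _ st); ring.
case: ifP => o lt.
- have [m e] : exists m : nat, s i = t i + m%:Z + 1.
    by exists `|(s i - t i - 1)%R|%N; lia.
  apply: (@AltCutOdd _ _ i m) => // b x y.
  have := E b x y; rewrite exprNn -signr_odd [odd _]/= o expr0 mul1r e !intrD.
  by rewrite -[(m%:Z)%:~R]/(m%:R : R); lra.
- have [m e] : exists m : nat, t i = s i + m%:Z + 1.
    by exists `|(t i - s i - 1)%R|%N; lia.
  apply: (@AltCutEven _ _ i m) => //; first by rewrite o.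
  move=> b x y.
  have := E b x y; rewrite exprNn -signr_odd [odd _]/= o expr1 mulN1r e !intrD.
  by rewrite -[(m%:Z)%:~R]/(m%:R : R); lra.
Qed.

(** The closed interval makes this stable under limits in the base; in return, a digit that leads to
    [0] or [1] has an alternative. *)
Definition weak b t x := forall n, 0 <= orb b t x n <= 1.

Lemma weak_shift b t x n : weak b t x -> weak b (shift n t) (orb b t x n).
Proof. by move=> wk m; rewrite -orbD. Qed.

Lemma weak_cut_le b s t x y : 0 < b -> alt_lt s t ->
  weak b s x -> weak b t y -> x <= y.
Proof.
move=> b0 /alt_cut st wx wy; rewrite -subr_ge0.
case: st => i m _ _ _ /(_ b x y) E;
rewrite -(pmulr_rge0 _ (exprn_gt0 i.+1 b0)) E;
have /andP[? ?] := wx i.+1; have /andP[? ?] := wy i.+1;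
have := ler0n R m; lra.
Qed.

Lemma bernoulli_lb b n : 1 <= b -> 1 + n%:R * (b - 1) <= b ^+ n.
Proof.
move=> b1; elim: n => [|n IH]; first by rewrite expr0; lra.
rewrite exprS -natr1.
have h : 0 <= (b ^+ n - 1) * (b - 1).
  by rewrite mulr_ge0 // subr_ge0 // exprn_ege1.
lra.
Qed.

Lemma expr_unbounded b x : 1 < b -> exists n, x < b ^+ n.
Proof.
move=> b1; have [x0|x0] := ltP x 0; first by exists 0%N; rewrite expr0; lra.
have h : 0 <= x / (b - 1) by rewrite divr_ge0 //; lra.
exists (Num.bound (x / (b - 1))).
have := archi_boundP h; rewrite ltr_pdivrMr; last lra.
by have := bernoulli_lb (Num.bound (x / (b - 1))) (ltW b1); lra.
Qed.

Lemma expr_bounded_le0 b x y : 1 < b -> (forall n, b ^+ n * x <= y) -> x <= 0.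
Proof.
move=> b1 h; rewrite leNgt; apply/negP => x0.
have [n] := expr_unbounded (y / x) b1.
by rewrite ltr_pdivrMr // => /lt_le_trans/(_ (h n)); rewrite ltxx.
Qed.

(** Orbits with the same digits separate at the rate [b ^ n]. *)
Lemma bounded_orb_uniq b t x y B : 1 < b ->
  (forall n, `|orb b t x n| <= B) -> (forall n, `|orb b t y n| <= B) -> x = y.
Proof.
move=> b1 hx hy; apply/eqP; rewrite eq_sym -subr_eq0 -normr_le0.
apply: (@expr_bounded_le0 b _ (B + B)) => // n.
have <- : `|orb b t y n - orb b t x n| = b ^+ n * `|y - x|.
  by rewrite orb_sub normrM normrX normrN (gtr0_norm (lt_trans ltr01 b1)).
by rewrite (le_trans (ler_normB _ _)) // lerD.
Qed.

Lemma weak_norm b t x : weak b t x -> forall n, `|orb b t x n| <= 1.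
Proof. by move=> wk n; have /andP[? ?] := wk n; rewrite ger0_norm. Qed.

Lemma weak_uniq b t x y : 1 < b -> weak b t x -> weak b t y -> x = y.
Proof. by move=> b1 /weak_norm hx /weak_norm; apply: bounded_orb_uniq hx. Qed.

(* Nested intervals: after n digits x is known up to C b^-n. *)
Lemma bounded_orb_ex b t (A : R) : 1 < b ->
  (forall n, `|(t n)%:~R + 1| <= A) ->
  exists x, forall n, `|orb b t x n| <= A / (b - 1).
Proof.
(* [C] solves [b * C = A + C]: a point within [C] of [0] at time [n + 1] comes from one within [C]
   at time [n], so the intervals below are nested. *)
move=> b1 tA; set C := A / (b - 1).
have b0 : b != 0 by lra.
have bn0 : (- b) != 0 by rewrite oppr_eq0.
have C0 : 0 <= C.
  by rewrite divr_ge0 ?(le_trans _ (tA 0%N)) //; lra.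
have eA : A = C * b - C.
  by have : C * (b - 1) = A by [rewrite /C divfK //; lra]; lra.
pose L n : R := - orb b t 0 n / (- b) ^+ n - C / b ^+ n.
pose U n : R := - orb b t 0 n / (- b) ^+ n + C / b ^+ n.
have LU n : L n <= U n.
  have := divr_ge0 C0 (exprn_ge0 n (ltW (lt_trans ltr01 b1))).
  by rewrite /L /U; lra.
have step n : L n <= L n.+1 /\ U n.+1 <= U n.
  have e : - orb b t 0 n.+1 / (- b) ^+ n.+1 =
     - orb b t 0 n / (- b) ^+ n - ((t n)%:~R + 1) / (- b) ^+ n.+1.
    by rewrite /= exprS; field; rewrite expf_neq0.
  have e' : C / b ^+ n = A / b ^+ n.+1 + C / b ^+ n.+1.
    by rewrite eA exprS; field; rewrite b0 expf_neq0.
  have : `|((t n)%:~R + 1) / (- b) ^+ n.+1| <= A / b ^+ n.+1.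
    rewrite normrM normfV normrX normrN (gtr0_norm (lt_trans ltr01 b1)).
    by rewrite ler_wpM2r // invr_ge0 exprn_ge0 //; lra.
  rewrite ler_norml => /andP[h1 h2]; rewrite /L /U e e'; split; lra.
have Lm : {homo L : m n / (m <= n)%N >-> m <= n}.
  by apply: homo_leq => // [y x z|n]; [exact: le_trans|case: (step n)].
have Um : {homo U : m n / (m <= n)%N >-> n <= m}.
  apply: homo_leq => // [y x z h1 h2|n]; first exact: le_trans h2 h1.
  by case: (step n).
have LUmn m n : L m <= U n.
  case: (leqP m n) => [/Lm/le_trans|/ltnW/Um]; first exact.
  exact/le_trans.
have ub : has_sup [set x | exists n, x = L n].
  split; first by exists (L 0%N), 0%N.
  by exists (U 0%N) => x [n ->].
exists (sup [set x | exists n, x = L n]) => n.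
set x := sup _.
have lx : L n <= x by apply: sup_upper_bound => //; exists n.
have xu : x <= U n by apply: ge_sup => [|y [m ->]//]; case: ub.
have -> : orb b t x n = (- b) ^+ n * (x + orb b t 0 n / (- b) ^+ n).
  have := orb_sub b t 0 x n; rewrite subr0 => /eqP; rewrite subr_eq => /eqP->.
  by field; rewrite expf_neq0.
rewrite normrM normrX normrN (gtr0_norm (lt_trans ltr01 b1)).
have -> : C = b ^+ n * (C / b ^+ n) by field; rewrite expf_neq0.
rewrite ler_wpM2l ?exprn_ge0 //; first lra.
by rewrite ler_norml; move: lx xu; rewrite /L /U; lra.
Qed.

End Orbits.

(** * Itineraries *)

Section Itineraries.
Variable R : realType.
Implicit Types (b x y : R) (s t w : zseq) (m n k : nat).

(** A bounded orbit with digits [t] leaves [[0, 1]] by at most some [K], and [step] improves [K] to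
    [K / b], so it does not leave at all. The lower bound comes from the sign of the digits, the
    upper one from cutting a tail of [t] against [w]. *)
Lemma weak_realize b w t : 1 < b -> weak b w 1 -> (forall n, 0 <= t n) ->
  (forall n, alt_le (shift n t) w) -> exists x, weak b t x.
Proof.
move=> b1 ww t0 tw; have b0 : 0 < b by lra.
have tA n : `|(t n)%:~R + 1 : R| <= (w 0%N)%:~R + 1.
  have := alt_le0 (tw n); rewrite /shift addn0 -(ler_int R).
  by have := t0 n; rewrite -(ler_int R) => ? ?; rewrite ger0_norm; lra.
have [x xB] := bounded_orb_ex b1 tA; exists x.
set B := _ / _ in xB.
pose X n := orb b t x n.
have step K : 0 <= K -> (forall n, - K <= X n <= 1 + K) ->
    forall n, - (K / b) <= X n <= 1 + K / b.
  move=> K0 hK n; apply/andP; split.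
    have e : b * X n = (t n)%:~R + 1 - X n.+1 by rewrite /X /=; ring.
    have /andP[_ ?] := hK n.+1.
    have := t0 n; rewrite -(ler_int R) => ?.
    by rewrite -mulNr ler_pdivrMr // mulrC e; lra.
  rewrite -lerBlDl.
  case: (tw n) => [lt|eq].
    suff [i h] : exists i, - K <= b ^+ i.+1 * (1 - X n).
      have h' : - K <= b * (1 - X n).
        have [c|c] := leP 0 (1 - X n).
          by rewrite (@le_trans _ _ 0) ?mulr_ge0 //; lra.
        apply: (le_trans h); apply: ler_wnM2r; first exact: ltW.
        by rewrite exprS ler_peMr ?exprn_ege1 // ltW.
      by rewrite ler_pdivlMr //; lra.
    case: (alt_cut R lt) => i m _ _ _ /(_ b (X n) 1) e; exists i; rewrite e -orbD;
    have := ww i.+1; have := hK (n + i.+1)%N; rewrite /X;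
    by have := ler0n R m; lra.
  have -> : X n = 1.
    apply: (@bounded_orb_uniq _ b w _ _ (Num.max B 1)) => // j.
      by rewrite -eq -orbD le_max xB.
    by rewrite le_max (weak_norm ww) orbT.
  by rewrite subrr divr_ge0 // ltW.
have B0 : 0 <= B := le_trans (normr_ge0 _) (xB 0%N).
have all N : forall n, - (B / b ^+ N) <= X n <= 1 + B / b ^+ N.
  elim: N => [|N IH].
    by move=> n; have := xB n; rewrite ler_norml -/(X n); lra.
  rewrite exprSr invfM mulrA; apply: step => //.
  by rewrite divr_ge0 // exprn_ge0 // ltW.
move=> n; rewrite -/(X n); apply/andP; split; rewrite -subr_le0 ?sub0r;
  apply: (@expr_bounded_le0 _ b _ B) => // N;
  rewrite mulrC -ler_pdivlMr ?exprn_gt0 //; have := all N n; lra.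
Qed.

Definition gmap b y : R := (Num.floor (b * y))%:~R + 1 - b * y.

Definition itin b y : zseq := fun n => Num.floor (b * iter n (gmap b) y).

Notation kn b := (itin b 1).

Lemma gmap_itv b y : 0 < gmap b y <= 1.
Proof.
have := floor_itv (b * y); rewrite /gmap intrD.
by move=> /andP[? ?]; apply/andP; split; lra.
Qed.

Lemma orb_itin b y n : orb b (itin b y) y n = iter n (gmap b) y.
Proof. by elim: n => //= n ->. Qed.

Lemma itin_orb b y : 0 < y <= 1 -> forall n, 0 < orb b (itin b y) y n <= 1.
Proof. by move=> y1 [//|n]; rewrite orb_itin /= gmap_itv. Qed.

Lemma itin_weak b y : 0 < y <= 1 -> weak b (itin b y) y.
Proof. by move=> y1 n; have /andP[/ltW-> ->] := itin_orb b y1 n. Qed.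

(** A digit is the floor as soon as the next point lies in [(0, 1]]; hence [k] digits involve the
    points up to index [k]. *)
Lemma itin_eq b t y k : (forall j, (j <= k)%N -> 0 < orb b t y j <= 1) ->
  forall j, (j < k)%N -> t j = itin b y j.
Proof.
move=> h; elim: k h => // k IH h j.
have {}IH i : (i < k)%N -> t i = itin b y i.
  by apply: IH => l lk; apply: h; apply: leqW.
rewrite ltnS leq_eqVlt => /predU1P[->|/IH//].
rewrite /itin -orb_itin -(eq_orb _ _ IH); symmetry; apply: floor_def.
by have := h k.+1 (leqnn _); rewrite /= intrD; lra.
Qed.

Lemma itin_eqP b t y : (forall n, 0 < orb b t y n <= 1) -> t = itin b y.
Proof. by move=> h; apply/funext => n; apply: (@itin_eq b t y n.+1). Qed.

Lemma itin_shift b y n : itin b (orb b (itin b y) y n) = shift n (itin b y).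
Proof.
by apply/funext => k; rewrite /itin /shift orb_itin -iterD addnC.
Qed.

Lemma itin_ge0 b y : 0 < b -> 0 < y <= 1 -> forall n, 0 <= itin b y n.
Proof.
move=> b0 y1 n; rewrite /itin floor_ge0 mulr_ge0 ?ltW // -orb_itin.
by have /andP[] := itin_orb b y1 n.
Qed.

Lemma itin_lt b x y : 1 < b -> 0 < x -> x < y -> y <= 1 ->
  alt_lt (itin b x) (itin b y).
Proof.
move=> b1 x0 xy y1.
have wx : weak b (itin b x) x by apply: itin_weak; lra.
have wy : weak b (itin b y) y by apply: itin_weak; lra.
case: (alt_total (itin b x) (itin b y)) => // h.
  by rewrite -h in wy; have := weak_uniq b1 wx wy; lra.
by have := @weak_cut_le _ b _ _ _ _ ltac:(lra) h wy wx; lra.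
Qed.

Lemma itin_le b x y : 1 < b -> 0 < x -> x <= y -> y <= 1 ->
  alt_le (itin b x) (itin b y).
Proof.
move=> b1 x0; rewrite le_eqVlt => /predU1P[->|xy y1]; first by right.
by left; apply: itin_lt.
Qed.

Lemma itin_shift_le b x n : 1 < b -> 0 < x <= 1 ->
  alt_le (shift n (itin b x)) (kn b).
Proof.
move=> b1 x1; rewrite -itin_shift.
by have /andP[? ?] := itin_orb b x1 n; apply: itin_le.
Qed.

Lemma kn_weak b : weak b (kn b) 1.
Proof. by apply: itin_weak; rewrite ltr01 lexx. Qed.

Lemma expansionE b : 1 < b -> expansion b (- b / (b + 1)) = kn b.
Proof.
move=> b1; apply/funext => n; rewrite /expansion /itin.
have e : b / (b + 1) + 1 / (b + 1) = 1 by field; lra.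
have T x : b / (b + 1) - b * (1 / (b + 1) - x) = b * x.
  by field; lra.
suff -> : iter n (Tneg b) (- b / (b + 1)) =
    1 / (b + 1) - iter n (gmap b) 1 by rewrite T.
elim: n => [|n IH] /=; first by rewrite mulNr; lra.
by rewrite IH /Tneg T /gmap; field; lra.
Qed.

End Itineraries.
Notation kn b := (itin b 1).

(** * Bases close to 1 *)

Section NearOne.
Variable R : realType.
Implicit Types (b x y D E : R) (v w : seq bool).

Fixpoint worb b w x : R :=
  if w is d :: w' then worb b w' (d%:R + 1 - b * x) else x.

(** The starting point is not tested, so that orbits may start at [1]. *)
Fixpoint inside b w x : bool :=
  if w is d :: w' then
    (0 < d%:R + 1 - b * x < 1) && inside b w' (d%:R + 1 - b * x)
  else true.

Lemma worb_cat b v w x : worb b (v ++ w) x = worb b w (worb b v x).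
Proof. by elim: v x => /=. Qed.

Lemma inside_cat b v w x :
  inside b (v ++ w) x = inside b v x && inside b w (worb b v x).
Proof. by elim: v x => //= d v IH x; rewrite IH andbA. Qed.

Lemma inside_orb b w t x : inside b w x ->
  (forall i, (i < size w)%N -> t i = (nth false w i : nat)%:Z) ->
  forall j, (0 < j <= size w)%N -> 0 < orb b t x j < 1.
Proof.
elim: w t x => [|d w IH] t x /=; first by move=> _ _ [].
case/andP=> h ins tw [//|j] /andP[_ jw].
have e : orb b t x 1 = d%:R + 1 - b * x by rewrite /= (tw 0%N).
rewrite -(add1n j) orbD e; case: j jw => [//|j jw].
by apply: IH => // i iw; rewrite /shift (tw i.+1).
Qed.

Lemma iter_phi_cat n v w : iter n phi (v ++ w) = iter n phi v ++ iter n phi w.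
Proof. by elim: n => //= n ->; rewrite phi_cat. Qed.

(** Apply [phi^(m+1)] to [phi(1) = 100] and use [phi(0) = 1]. *)
Lemma phi_iter_rec m :
  phi_iter m.+2 = phi_iter m.+1 ++ phi_iter m ++ phi_iter m.
Proof.
rewrite {1}/phi_iter iterSr.
rewrite -[phi _]/([:: true] ++ [:: false] ++ [:: false]) 2!iter_phi_cat.
by rewrite [iter _ _ [:: false]]iterSr.
Qed.

Notation p m := (size (phi_iter m)).

Lemma size_phi_iter_rec m : p m.+2 = (p m.+1 + (p m + p m))%N.
Proof. by rewrite phi_iter_rec !size_cat. Qed.

Lemma size_phi_iter_ltS m : (p m < p m.+1)%N.
Proof.
case: m => [//|m]; rewrite size_phi_iter_rec -{1}(addn0 (p m.+1)) ltn_add2l.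
by rewrite addn_gt0 (leq_ltn_trans (leq0n m) (size_phi_iter m)).
Qed.

(** The distance to [1] from which the block [phi^m(1)] leads exactly to [1]. *)
Fixpoint dmax b m : R :=
  if m is n.+1 then dmax b n * (1 - b ^- p n) else 1 - b^-1.

Lemma dmax_gt0 b m : 1 < b -> 0 < dmax b m.
Proof.
move=> b1; elim: m => [|m IH] /=.
  by rewrite subr_gt0 invf_lt1 //; lra.
rewrite mulr_gt0 // subr_gt0 invf_lt1 ?exprn_gt0 //; last lra.
by rewrite exprn_egt1 // -lt0n (leq_ltn_trans (leq0n m) (size_phi_iter m)).
Qed.

Lemma dmax_le b m : 1 < b -> dmax b m.+1 <= dmax b m.
Proof.
move=> b1; rewrite /= ler_piMr ?(ltW (dmax_gt0 _ _)) //.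
by rewrite gerBl invr_ge0 exprn_ge0 //; lra.
Qed.

(* In terms of the distance D to 1, the block phi^m(1) acts by
   D -> b^p (dmax b m - D). *)
Lemma worb_phi_iter b m D : b != 0 -> worb b (phi_iter m) (1 - D) =
  1 - b ^+ p m * (dmax b m - D).
Proof.
move=> b0; elim/ltn_ind: m D => -[_ D|[_ D|m IH D]].
- by rewrite /= expr1; field.
- by rewrite /=; field.
rewrite phi_iter_rec 2!worb_cat !IH // -phi_iter_rec size_phi_iter_rec.
rewrite [dmax b m.+2]/= [dmax b m.+1]/= !exprD.
by field; rewrite !expf_neq0.
Qed.

(** Induction along [phi_iter_rec]: the distance left by each of the three blocks must be in the
    range allowed for the next one. *)
Lemma inside_phi_iter b m D : 1 < b ->
  (if m is n.+1 then b ^+ (p n).+1 < 2 else b < 2) ->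
  0 <= D < dmax b m -> inside b (phi_iter m) (1 - D).
Proof.
move=> b1; have b0 : b != 0 by lra.
have bgt0 : 0 < b by lra.
elim/ltn_ind: m D => -[_|[_|m IH]] D.
- move=> /= b2 /andP[D0]; rewrite -(ltr_pM2l bgt0).
  have -> : b * (1 - b^-1) = b - 1 by field.
  by move=> D1; have := mulr_ge0 (ltW bgt0) D0; rewrite andbT; lra.
- rewrite /= expr1 expr2 => b2 /andP[D0].
  rewrite -(ltr_pM2l bgt0) -(ltr_pM2l bgt0).
  have -> : b * (b * ((1 - b^-1) * (1 - b^-1))) = (b - 1) * (b - 1) by field.
  move=> D1.
  have h1 : b * D < b - 1 by nra.
  have h2 : b * ((b - 1) * (b - 1)) < 1 by nra.
  have h3 : 0 <= b * (b * (b * D)) by rewrite !mulr_ge0 //; lra.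
  have h4 : b * (b * (b * D)) < b * ((b - 1) * (b - 1)).
    by rewrite ltr_pM2l //; lra.
  have h5 : 0 <= b * D by rewrite mulr_ge0 //; lra.
  have h6 : 0 <= b * (b * D) by rewrite !mulr_ge0 //; lra.
  by rewrite andbT; apply/and3P; split; apply/andP; split; nra.
- move=> bp /andP[D0 D1].
  have p1 := size_phi_iter_ltS m.
  have b1' n : 1 <= b ^+ n by rewrite exprn_ege1 // ltW.
  have bn n : 0 < b ^+ n by rewrite exprn_gt0 //; lra.
  have IH1 E : 0 <= E < dmax b m.+1 -> inside b (phi_iter m.+1) (1 - E).
    apply: IH => //; apply: le_lt_trans bp.
    by rewrite ler_weXn2l ?ltW // ltnS ltnW.
  have IH0 E : 0 <= E < dmax b m -> inside b (phi_iter m) (1 - E).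
    apply: IH => //; case: (m) p1 bp => [|n] p1 bp.
      by apply: le_lt_trans bp; rewrite -{1}(expr1 b) ler_weXn2l // ltW.
    apply: le_lt_trans bp; rewrite ler_weXn2l // ?ltW // ltnS.
    by rewrite ltnW // (ltn_trans _ p1) // size_phi_iter_ltS.
  (* With [B = b ^ p m.+1] this reduces to [B - b < 1], a consequence of [b * B < 2]. *)
  have key : b ^+ p m.+1 * dmax b m.+1 < dmax b m.
    rewrite [dmax b m.+1]/= mulrCA gtr_pMr ?dmax_gt0 //.
    have -> : b ^+ p m.+1 * (1 - b ^- p m) = b ^+ p m.+1 - b ^+ (p m.+1 - p m).
      by rewrite expfB // mulrBr mulr1.
    have h1 : b <= b ^+ (p m.+1 - p m).
      by rewrite -{1}(expr1 b) ler_weXn2l ?ltW // subn_gt0.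
    rewrite exprS in bp; have := b1' (p m.+1); nra.
  have c1 := dmax_le m.+1 b1.
  rewrite phi_iter_rec !inside_cat IH1; last lra.
  rewrite worb_phi_iter //; set D1' := _ * _.
  have q1 : 0 < D1' by rewrite mulr_gt0 // subr_gt0; lra.
  have q2 : D1' < dmax b m.
    by apply: le_lt_trans key; apply: ler_wpM2l; [exact: ltW|lra].
  rewrite IH0; last lra.
  rewrite worb_phi_iter // IH0 //; apply/andP; split.
    by rewrite mulr_ge0 ?ltW // subr_gt0.
  (* The second block leaves a distance below [dmax b m] because the third one turns it into the
     final distance, which is positive. *)
  have : 0 < b ^+ p m * (dmax b m - b ^+ p m * (dmax b m - D1')).
    have -> : b ^+ p m * (dmax b m - b ^+ p m * (dmax b m - D1')) =
        b ^+ p m.+2 * (dmax b m.+2 - D).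
      rewrite /D1' size_phi_iter_rec [dmax b m.+2]/= [dmax b m.+1]/= !exprD.
      by field; rewrite !expf_neq0.
    by rewrite mulr_gt0 // subr_gt0.
  by rewrite pmulr_rgt0 // subr_gt0.
Qed.

Lemma orb_u_inside b k : 1 < b -> b ^+ k < 2 ->
  forall j, (0 < j <= k)%N -> 0 < orb b u 1 j < 1.
Proof.
move=> b1 bk j /andP[j0 jk].
(* By minimality the block before [phi_iter m] is shorter than [k], so [b ^ k < 2] gives the bound
   that [inside_phi_iter] asks for. *)
have [m km mmin] := ex_minnP (ex_intro (fun m => (k <= p m)%N) k
  (ltnW (size_phi_iter k))).
have ins : inside b (phi_iter m) 1.
  rewrite -[1]subr0; apply: inside_phi_iter => //.
    case: m {km} mmin => [|m] mmin.
      apply: le_lt_trans bk; rewrite -{1}(expr1 b) ler_weXn2l ?ltW //.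
      by rewrite (leq_trans j0).
    apply: le_lt_trans bk; rewrite ler_weXn2l ?ltW // ltnNge.
    by apply/negP => /mmin; rewrite ltnn.
  by rewrite lexx dmax_gt0.
apply: (inside_orb ins) => [i|]; first exact: u_phi_iter.
by rewrite j0 (leq_trans jk).
Qed.

Lemma kn_eq_u b k : 1 < b -> b ^+ k < 2 ->
  forall j, (j < k)%N -> kn b j = u j.
Proof.
move=> b1 bk j jk; symmetry; move: jk; apply: itin_eq => -[_|i ik].
  by rewrite ltr01 lexx.
by have /andP[-> /ltW] := orb_u_inside b1 bk (j := i.+1) ik.
Qed.

Lemma base_near1 k : exists2 b : R, 1 < b & b ^+ k < 2.
Proof.
elim: k => [|k [b b1 bk]]; first by exists 2; rewrite ?expr0; lra.
have hb : 1 <= b ^+ k by rewrite exprn_ege1 // ltW.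
pose e := Num.min (b - 1) ((2 - b ^+ k) / 4).
have e0 : 0 < e by rewrite lt_min; apply/andP; split; lra.
have /andP[eb ek] : (e <= b - 1) && (e <= (2 - b ^+ k) / 4).
  by rewrite /e !ge_min !lexx orbT.
exists (1 + e); first lra.
have h : (1 + e) ^+ k <= b ^+ k by apply: lerXn2r; rewrite ?nnegrE; lra.
by rewrite exprS; nra.
Qed.

End NearOne.

(** * Monotonicity in the base *)

Section Monotonicity.
Variables (R : realType) (b g : R).
Hypotheses (b1 : 1 < b) (bg : b < g).
(* The value in base b of the expansion of x in base g; it exists as soon as
   kn g <= kn b, and is a monotone semiconjugacy. *)
Variable th : R -> R.
Hypothesis thP : forall x, 0 < x <= 1 -> weak b (itin g x) (th x).

Let g1 : 1 < g. Proof. exact: lt_trans bg. Qed.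
Let b0 : 0 < b. Proof. exact: lt_trans b1. Qed.
Let g0 : 0 < g. Proof. exact: lt_trans g1. Qed.
Let one1 : 0 < (1 : R) <= 1. Proof. by rewrite ltr01 lexx. Qed.
Let Y k := orb g (kn g) 1 k.
Let Y_itv k : 0 < Y k <= 1. Proof. exact: itin_orb. Qed.

Lemma th_itv x : 0 < x <= 1 -> 0 <= th x <= 1.
Proof. by move=> x1; apply: (thP x1 0). Qed.

Lemma th_orb x n : 0 < x <= 1 ->
  orb b (itin g x) (th x) n = th (orb g (itin g x) x n).
Proof.
move=> x1; apply: (@weak_uniq _ b (shift n (itin g x))) => //.
  by apply: weak_shift; apply: thP.
by rewrite -itin_shift; apply: thP; apply: itin_orb.
Qed.

Lemma th_le x y : 0 < x -> x <= y -> y <= 1 -> th x <= th y.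
Proof.
move=> x0; rewrite le_eqVlt => /predU1P[->//|xy y1].
apply: (weak_cut_le b0 (itin_lt g1 x0 xy y1)); apply: thP; lra.
Qed.

Lemma th_step x : 0 < x <= 1 -> exists d y,
  [/\ 0 <= d, 0 < y <= 1, d = 0 \/ 1 <= d, g * x = d + 1 - y
    & b * th x = d + 1 - th y].
Proof.
move=> x1; have t0 := itin_ge0 g0 x1 0.
exists (itin g x 0)%:~R, (orb g (itin g x) x 1); split.
- by rewrite ler0z.
- exact: itin_orb.
- move: t0; rewrite le_eqVlt => /predU1P[<-|t0]; first by left.
  by right; rewrite ler1z.
- by rewrite /=; ring.
- by rewrite -th_orb //=; ring.
Qed.

(** The same digits cut [[z, 1]] in base [g] and its image in base [b]; one of the two end pieces is
    bounded by a point of the orbit of [1]. *)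
Lemma th_cut z : 0 < z < 1 -> exists k (m : nat) x y,
  [/\ 0 < x <= 1, 0 < y <= 1, y = Y k.+1 \/ x = Y k.+1,
     g ^+ k.+1 * (1 - z) = m%:R + x + (1 - y)
   & b ^+ k.+1 * (th 1 - th z) = m%:R + th x + (1 - th y)].
Proof.
move=> /andP[z0 z1].
have zi : 0 < z <= 1 by lra.
case: (alt_cut R (itin_lt g1 z0 z1 (lexx 1))) => k m _ _ _ e.
- exists k, m, (orb g (itin g z) z k.+1), (Y k.+1); split => //.
  + exact: itin_orb.
  + by left.
  + by rewrite -!th_orb.
- exists k, m, (Y k.+1), (orb g (itin g z) z k.+1); split => //.
  + exact: itin_orb.
  + by right.
  + by rewrite -!th_orb.
Qed.

(* If th = 1 on a maximal interval of length s below 1, then the two pieces of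
   its first cut, at time k, have lengths at most s and s / g, whence
   g ^ (k + 1) <= g + 1: this only happens where kn g still agrees with u. *)
Lemma th_lt1 z : 0 < z < 1 -> th z < 1.
Proof.
have [gt1_b gt1_g gt0_b gt0_g] := And4 b1 g1 b0 g0.
move=> /andP[z0 z1]; rewrite ltNge; apply/negP => thz.
pose S := [set s | exists x, [/\ 0 < x <= 1, th x = 1 & s = 1 - x]].
have Sz : S (1 - z).
  exists z; split; rewrite ?z0 ?ltW //; apply/eqP.
  by rewrite eq_le thz; have /andP[_ ->] : 0 <= th z <= 1 by apply: th_itv; lra.
have hS : has_sup S.
  by split; [exists (1 - z)|exists 1 => _ [x [/andP[? ?] _ ->]]; lra].
set s := sup S.
have s0 : 0 < s.
  by rewrite (lt_le_trans _ (sup_upper_bound hS Sz)) // subr_gt0.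
have leS x : 0 < x <= 1 -> th x = 1 -> 1 - x <= s.
  by move=> x1 e; apply: sup_upper_bound => //; exists x.
(* Chosen so that the point [x] below satisfies [2 * g * (1 - x) > s * (g + 1)]. *)
have eps0 : 0 < s * (g - 1) / (2 * g).
  by apply: divr_gt0; [apply: mulr_gt0|]; lra.
have [_ [x [x1 thx ->]]] := sup_adherent eps0 hS.
have -> : sup S - s * (g - 1) / (2 * g) = s * (g + 1) / (2 * g).
  by rewrite -/s; field; lra.
rewrite ltr_pdivrMr => [sx|]; last lra.
have sg : 0 < s * (g + 1) by rewrite mulr_gt0 //; lra.
have x1' : 0 < x < 1.
  have : 0 < 1 - x by rewrite -(@pmulr_lgt0 _ (2 * g)); lra.
  by lra.
have th1 : th 1 = 1.
  have /andP[_ ?] := th_itv one1.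
  have := @th_le x 1 ltac:(lra) ltac:(lra) (lexx 1); lra.
have [k [m [y [w [y1 w1 Yk eg]]]]] := th_cut x1'.
rewrite th1 thx subrr mulr0 => eb.
have m0 := ler0n R m.
have /andP[thy0 thy1] := th_itv y1.
have /andP[thw0 thw1] := th_itv w1.
(* In [eb] a sum of nonnegative terms vanishes, so each of them does. *)
have em : m%:R = 0 :> R by lra.
have ey : th y = 0 by lra.
have ew : th w = 1 by lra.
have sw := leS _ w1 ew.
have [d [y' [d0 y'1 _ gy by']]] := th_step y1.
have thy' := th_itv y'1.
have ed : d = 0 by rewrite ey in by'; lra.
have ey' : th y' = 1 by rewrite ey in by'; lra.
have sy := leS _ y'1 ey'.
have gk : g ^+ k.+1 < 2.
  have h : g * (g ^+ k.+1 * (1 - x)) <= s * (g + 1).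
    by rewrite eg em !mulrDr mulr0; nra.
  have h' : g ^+ k.+1 * (s * (g + 1)) < 2 * (s * (g + 1)).
    apply: (@lt_le_trans _ _ (g ^+ k.+1 * ((1 - x) * (2 * g)))).
      by rewrite ltr_pM2l // exprn_gt0.
    by lra.
  by rewrite ltr_pM2r in h'.
have bk : b ^+ k.+1 < 2.
  by apply: le_lt_trans gk; apply: lerXn2r; rewrite ?nnegrE ltW.
(* [kn g] and [u] share [k + 1] letters, so this orbit point is [th (Y k.+1)], which is [0] or [1],
   whereas the orbit along [u] is strictly inside. *)
have := orb_u_inside b1 bk (j := k.+1) (leqnn _).
have -> : orb b u 1 k.+1 = th (Y k.+1).
  by rewrite -th_orb // th1 (eq_orb b 1 (kn_eq_u g1 gk)).
by case: Yk => <-; rewrite ?ey ?ew; lra.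
Qed.

Lemma Y_sep M : exists2 r, 0 < r & forall k, (k < M)%N ->
  r <= Y k.+1 /\ (Y k.+1 < 1 -> r <= 1 - Y k.+1).
Proof.
elim: M => [|M [r r0 rM]]; first by exists 1.
have /andP[Y0 Y1] := Y_itv M.+1.
pose q := if Y M.+1 < 1 then 1 - Y M.+1 else 1.
have q0 : 0 < q by rewrite /q; case: ifP; lra.
exists (Num.min r (Num.min (Y M.+1) q)); first by rewrite !lt_min r0 Y0 q0.
move=> k; rewrite ltnS leq_eqVlt => /predU1P[->|/rM[h1 h2]].
  by rewrite !ge_min lexx orbT /q; split=> // ->; rewrite lexx !orbT.
by rewrite !ge_min h1; split=> // /h2 ->.
Qed.

(* A bound 1 - th z >= c (1 - z), once valid, improves by a factor
   close to g / b under the two maps, until it contradicts th >= 0. The error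
   term kap gives a first such bound; doubled by a cut, it is absorbed by
   b ^ k > 2 for late cuts, and by the lower bound r on the size of the cut for
   early ones. *)
Lemma th_false : False.
Proof.
have [gt1_b gt1_g gt0_b gt0_g ltbg] := And5 b1 g1 b0 g0 bg.
(* [lam] and [e] share the gap between the slopes: [lam * b = (1 - e) * g = (b + g) / 2]. *)
pose lam := (b + g) / (2 * b).
pose e := (g - b) / (2 * g).
have lamE : lam * (2 * b) = b + g by rewrite /lam divfK //; lra.
have eE : e * (2 * g) = g - b by rewrite /e divfK //; lra.
have lam1 : 1 < lam by rewrite /lam ltr_pdivlMr; lra.
have e0 : 0 < e by apply: divr_gt0; lra.
have lam_exp k : lam * b ^+ k.+1 <= (1 - e) * g ^+ k.+1.
  have h : b ^+ k <= g ^+ k by apply: lerXn2r; rewrite ?nnegrE ltW.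
  have -> : lam * b ^+ k.+1 = (b + g) / 2 * b ^+ k.
    by rewrite exprS /lam; field; lra.
  have -> : (1 - e) * g ^+ k.+1 = (b + g) / 2 * g ^+ k.
    by rewrite exprS /e; field; lra.
  by rewrite ler_pM2l // divr_gt0 //; lra.
clearbody lam e.
have [M bM] := expr_unbounded 2 b1.
have [r r0 rM] := Y_sep M.
(* The first bound lets [e] times the size of an early cut absorb [2 * kap]; the second makes
   [Q lam] contradict [th kap >= 0]. *)
pose kap := Num.min (e * r / 2) ((lam - 1) / (lam * 4)).
have kap0 : 0 < kap.
  rewrite lt_min; apply/andP; split; apply: divr_gt0; rewrite ?mulr_gt0; lra.
have /andP[kap1 kap2] : (kap <= e * r / 2) && (kap <= (lam - 1) / (lam * 4)).
  by rewrite /kap !ge_min !lexx orbT.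
rewrite ler_pdivlMr in kap2; last lra.
clearbody kap.
have kap3 : kap < 1 by nra.
pose Q c := forall z, 0 < z <= 1 -> c * (1 - z - kap) <= 1 - th z.
have Qle c c' : 0 <= c' -> c' <= c -> Q c -> Q c'.
  move=> c0 cc Qc z z1; have := Qc z z1; have := th_itv z1.
  by have [h|h] := leP 0 (1 - z - kap); nra.
(* One step of the maps turns a piece ending at [0] into one ending at [1], where [Q c] applies. *)
have Qlow c x : 0 <= c <= 1 -> Q c -> 0 < x <= 1 -> c * (x - kap) <= th x.
  move=> /andP[c0 c1] Qc x1.
  have [d [y [d0 y1 _ gx bx]]] := th_step x1.
  have h1 : c * d <= d by nra.
  have h2 : c * (g * x - kap) <= b * th x by rewrite gx bx; have := Qc y y1; lra.
  rewrite -(ler_pM2l b0); apply: le_trans h2.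
  by rewrite mulrCA ler_wpM2l //; nra.
have step c : 0 < c <= 1 -> Q c -> Q (lam * c).
  move=> /andP[c0 c1] Qc z /andP[z0]; rewrite le_eqVlt => /predU1P[->|z1].
    have := th_itv one1; have : 0 < lam * c by rewrite mulr_gt0 //; lra.
    nra.
  have zi : 0 < z < 1 by rewrite z0.
  have [k [m [x [y [x1 y1 Yk eg eb]]]]] := th_cut zi.
  have bk0 : 0 < b ^+ k.+1 by rewrite exprn_gt0.
  have bk1 : 1 <= b ^+ k.+1 by rewrite exprn_ege1 // ltW.
  have gk0 : 0 < g ^+ k.+1 by rewrite exprn_gt0.
  have cm : c * m%:R <= m%:R by rewrite ler_piMl.
  have hx := Qlow c x ltac:(lra) Qc x1.
  have hy := Qc y y1.
  have /andP[_ th11] := th_itv one1.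
  have B2 : (M <= k)%N -> 2 <= b ^+ k.+1.
    by move=> Mk; rewrite (le_trans (ltW bM)) // ler_weXn2l ?ltW // leqW.
  have := lam_exp k; set B := b ^+ k.+1 in bk0 bk1 B2 eb *; set G := g ^+ k.+1 in eg gk0 *.
  clearbody B G => lamBG.
  (* [f] is the total error of the cut: each of the two end pieces costs at most [kap]. *)
  have main f : c * (G * (1 - z) - f) <= m%:R + th x + (1 - th y) ->
      f <= e * (G * (1 - z)) + kap * (lam * B) -> lam * c * (1 - z - kap) <= 1 - th z.
    move=> h1 h2; rewrite -(ler_pM2l bk0).
    apply: (@le_trans _ _ (B * (th 1 - th z))); last by rewrite ler_pM2l //; lra.
    rewrite eb; apply: le_trans h1.
    have -> : B * (lam * c * (1 - z - kap)) =
      c * (lam * B * (1 - z) - kap * (lam * B)) by ring.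
    rewrite ler_pM2l //.
    have := @ler_wpM2r _ (1 - z) ltac:(lra) _ _ lamBG; lra.
  have kB : kap <= kap * (lam * B) by rewrite ler_peMr ?mulr_ege1 ?(ltW kap0) ?(ltW lam1).
  have G0 : 0 < e * (G * (1 - z)) by rewrite !mulr_gt0 // subr_gt0.
  have two : c * (G * (1 - z) - 2 * kap) <= m%:R + th x + (1 - th y).
    by rewrite eg; lra.
  have [Mk|kM] := leqP M k.
    apply: main two _.
    have l2 : 2 <= lam * B by have := B2 Mk; nra.
    by have := ler_wpM2l (ltW kap0) l2; lra.
  have [rk1 rk2] := rM k kM.
  (* When [y = 1] the piece ending at [1] is empty and costs nothing; the remaining single [kap] is
     covered by [kB]. *)
  have [y_1|y_n1] := eqVneq y 1.
    apply: (main kap); last lra.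
    rewrite eg y_1 subrr addr0; have := th_itv one1.
    by lra.
  apply: main two _.
  have : r <= G * (1 - z).
    rewrite eg; have := ler0n R m.
    case: Yk => eY; last by rewrite eY; lra.
    have : y < 1 by rewrite lt_neqAle y_n1; lra.
    by rewrite eY => /rk2; lra.
  by move=> h; have := @ler_wpM2l _ e (ltW e0) _ _ h; nra.
have k1 : 0 < 1 - kap < 1 by lra.
have thk := th_lt1 k1.
have thk' := @th_itv (1 - kap) ltac:(lra).
(* For [z <= 1 - kap] monotonicity gives [1 - th z >= c0]; beyond, the left side of [Q c0] is
   nonpositive. [th_lt1] makes [c0] positive. *)
pose c0 := 1 - th (1 - kap).
have Q0 : Q c0.
  move=> z z1; have := th_itv z1.
  have [h|h] := leP z (1 - kap); last by rewrite /c0; nra.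
  have := @th_le z (1 - kap) ltac:(lra) h ltac:(lra); rewrite /c0; nra.
have c00 : 0 < c0 by rewrite /c0; lra.
have Qn n : Q (Num.min 1 (c0 * lam ^+ n)).
  elim: n => [|n IH].
    apply: Qle Q0; first by rewrite le_min expr0 mulr1 ler01 ltW.
    by rewrite expr0 mulr1 ge_min lexx orbT.
  have l0 : 0 < c0 * lam ^+ n by rewrite mulr_gt0 // exprn_gt0 //; lra.
  apply: (@Qle (lam * Num.min 1 (c0 * lam ^+ n))).
  - by rewrite le_min ler01 mulr_ge0 ?exprn_ge0 // ltW //; lra.
  - have -> : c0 * lam ^+ n.+1 = lam * (c0 * lam ^+ n) by rewrite exprS; ring.
    by case: (leP 1 (c0 * _)) => _; rewrite ge_min ?mulr1 ?(ltW lam1) ?lexx ?orbT.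
  - apply: step => //; rewrite lt_min ltr01 l0 /=.
    by rewrite ge_min lexx.
have [n] := expr_unbounded c0^-1 lam1.
rewrite -(ltr_pM2l c00) divff ?gt_eqF // => hn.
have Q1 : Q 1 by have := Qn n; rewrite min_l // ltW.
have Ql : Q lam by rewrite -[lam]mulr1; apply: step; rewrite ?ltr01 ?lexx.
have kk : 0 < kap <= 1 by lra.
have := Ql kap kk; have := th_itv kk; nra.
Qed.

End Monotonicity.

Lemma kn_lt (R : realType) (b g : R) : 1 < b -> b < g ->
  alt_lt (kn b) (kn g).
Proof.
move=> b1 bg; apply: contrapT => /alt_leNgt kn_ge.
have g1 : 1 < g := lt_trans b1 bg.
have ex x : exists y, 0 < x <= 1 -> weak b (itin g x) y.
  have [x1|//] := boolP (0 < x <= 1); last by exists 0.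
  have [y wy] := weak_realize b1 (kn_weak b)
    (itin_ge0 (lt_trans ltr01 g1) x1)
    (fun n => alt_le_trans (itin_shift_le n g1 x1) kn_ge).
  by exists y.
by have [th thP] := choice ex; apply: (th_false b1 bg thP).
Qed.

(** * Existence of the base *)

Lemma alt_lt_prefix x y : alt_lt x y ->
  exists k, forall z, (forall j, (j < k)%N -> z j = x j) -> alt_lt z y.
Proof.
case=> k [xy nxy lt]; exists k.+1 => z zx.
by exists k; rewrite zx //; split=> // i ik; rewrite zx ?xy // leqW.
Qed.

Lemma alt_lt_prefixr x y : alt_lt x y ->
  exists k, forall z, (forall j, (j < k)%N -> z j = y j) -> alt_lt x z.
Proof.
case=> k [xy nxy lt]; exists k.+1 => z zy.
by exists k; rewrite zy //; split=> // i ik; rewrite zy ?xy // leqW.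
Qed.

Section Existence.
Variable R : realType.
Implicit Types (b g x y : R) (a t : zseq) (k n : nat).

Lemma kn_prefix_u k x : 1 < x ->
  exists b, 1 < b < x /\ forall j, (j < k)%N -> kn b j = u j.
Proof.
move=> x1; have [b b1 bk] := base_near1 R k.
exists (Num.min b ((1 + x) / 2)); split.
  rewrite lt_min b1 gt_min; apply/andP; split; first lra.
  by apply/orP; right; lra.
apply: kn_eq_u; first by rewrite lt_min b1; lra.
apply: le_lt_trans bk; apply: lerXn2r; rewrite ?nnegrE.
- by rewrite le_min; lra.
- lra.
- by rewrite ge_min lexx.
Qed.

(** For [1 < g < b], [kn g < u] would put [kn g] below [kn h] for some [h < g] whose itinerary
    follows [u] long enough; so [u <= kn g < kn b]. *)
Lemma kn_gt_u b : 1 < b -> alt_lt u (kn b).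
Proof.
move=> b1; have [g g1 gb] : exists2 g, 1 < g & g < b by exists ((1 + b) / 2); lra.
apply: alt_le_lt_trans (kn_lt g1 gb); apply: alt_leNgt => /alt_lt_prefixr[k hk].
have [h [/andP[h1 hg] /hk]] := kn_prefix_u k g1.
exact/alt_lt_asym/kn_lt.
Qed.

(** The excess of [d] over the fixed point [e / (b - 1)] is multiplied by at least [b] at each step,
    yet it is bounded. *)
Lemma perturbed_contraction_le b (d : nat -> R) (D e : R) n : 1 < b ->
  (forall i, d i <= D) -> (forall i, b * d i <= d i.+1 + e) ->
  d n <= e / (b - 1).
Proof.
move=> b1 dD dS; set f := e / (b - 1).
have ef : f * (b - 1) = e by rewrite /f divfK //; lra.
rewrite -subr_le0; apply: (@expr_bounded_le0 _ b _ (D - f)) => // k.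
suff h : b ^+ k * (d n - f) <= d (n + k)%N - f.
  by apply: le_trans h _; rewrite lerD2r.
elim: k => [|k IH]; first by rewrite addn0 mul1r.
rewrite exprS addnS -mulrA; apply: (le_trans (_ : _ <= b * (d (n + k)%N - f))).
  by rewrite ler_pM2l //; lra.
by have := dS (n + k)%N; rewrite -ef; lra.
Qed.

(** Bounded orbits with fixed digits depend continuously on the base, uniformly in time: the digits
    cancel in the difference. *)
Lemma orb_base_dist b g t x y B n : 1 < g ->
  weak b t x -> (forall i, `|orb g t y i| <= B) ->
  `|orb g t y n - orb b t x n| <= `|b - g| / (g - 1).
Proof.
move=> g1 wx yB; set d := fun i => `|orb g t y i - orb b t x i|.
apply: (@perturbed_contraction_le g d (B + 1)) => // i.
  apply: le_trans (ler_normB _ _) _; apply: lerD => //; exact: weak_norm.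
have h : g * d i <= d i.+1 + `|(b - g) * orb b t x i|.
  rewrite /d -{1}(gtr0_norm (lt_trans ltr01 g1)) -normrM.
  apply: le_trans (ler_normB _ _); rewrite -normrN le_eqVlt.
  by apply/orP; left; apply/eqP; congr (`|_|); rewrite /=; ring.
apply: le_trans h _; rewrite lerD2l normrM ler_piMr //; exact: weak_norm.
Qed.

Lemma weak_base_ex a : (forall n, 0 <= a n) ->
  (forall n, alt_le (shift n a) a) -> alt_lt u a ->
  exists2 b : R, 1 < b & weak b a 1.
Proof.
(* Everything that follows [u] for [k] letters is below [a]; this yields a base [h1 > 1] below the
   whole set [S]. *)
move=> a0 aa /alt_lt_prefix[k hk].
have [h1 [/andP[h11 _] /hk knh1]] := kn_prefix_u k (ltr1n R 2).
pose S := [set b : R | 1 < b /\ alt_le a (kn b)].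
have a0' : 0 <= (a 0%N)%:~R :> R by rewrite ler0z.
have S0 : S !=set0.
  exists ((a 0%N)%:~R + 2); split; first lra.
  have e : kn ((a 0%N)%:~R + 2 : R) 0 = a 0%N + 2.
    rewrite /itin /= mulr1; apply: floor_def.
    by rewrite !intrD; lra.
  by left; exists 0%N; rewrite e; split; rewrite ?lt_eqF ?ltrDl.
have lbS b : S b -> h1 < b.
  case=> b1 ab; rewrite ltNge; apply/negP.
  rewrite le_eqVlt => /predU1P[e|/(kn_lt b1) h].
    by rewrite -e in knh1; case: (alt_ltxx (alt_le_lt_trans ab knh1)).
  by case: (alt_ltxx (alt_le_lt_trans ab (alt_lt_trans h knh1))).
have hS : has_inf S by split => //; exists h1 => b /lbS/ltW.
set g := inf S.
have g1 : 1 < g by apply: (lt_le_trans h11); apply: lb_le_inf => // b /lbS/ltW.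
have above b : g < b -> exists x, weak b a x.
  rewrite -subr_gt0 => bg; have [b' [b'1 ab']] := inf_adherent bg hS.
  rewrite -/g addrC subrK => b'b.
  apply: weak_realize (kn_weak b) a0 _; first exact: lt_trans b'b.
  move=> n; apply: alt_le_trans (aa n) _; left.
  exact: alt_le_lt_trans ab' (kn_lt b'1 b'b).
have below b : 1 < b -> b < g -> alt_lt (kn b) a.
  move=> b1 bg; case: (alt_total (kn b) a) => // h.
    have : S b by split => //; right.
    by move=> /(ge_inf hS.2); rewrite -/g; lra.
  have : S b by split => //; left.
  by move=> /(ge_inf hS.2); rewrite -/g; lra.
have aA n : `|(a n)%:~R + 1 : R| <= (a 0%N)%:~R + 1.
  have := alt_le0 (aa n); rewrite /shift addn0 -(ler_int R).
  by have := a0 n; rewrite -(ler_int R) => ? ?; rewrite ger0_norm; lra.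
have [x xB] := bounded_orb_ex g1 aA.
(* Comparison with the base [g + d * (g - 1)], for which the bound of [orb_base_dist] is exactly
   [d]. *)
have near n d : 0 < d -> - d <= orb g a x n <= 1 + d.
  move=> d0; have [y wy] := above (g + d * (g - 1)) ltac:(nra).
  have := orb_base_dist n g1 wy xB.
  have -> : `|g + d * (g - 1) - g| / (g - 1) = d.
    by rewrite addrAC subrr add0r ger0_norm ?mulfK //; nra.
  by have := wy n; rewrite ler_norml; lra.
have wx : weak g a x.
  move=> n; apply/andP; split; rewrite leNgt; apply/negP => h.
    by have := near n (- orb g a x n / 2); lra.
  by have := near n ((orb g a x n - 1) / 2); lra.
exists g => //; suff <- : x = 1 by [].
have /andP[x0 x1] : 0 <= x <= 1 := wx 0%N.
apply/eqP; rewrite eq_le x1 leNgt; apply/negP => xlt1.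
(* In the slightly smaller base [b] the orbit with digits [a] starts at most [d] above [x], whereas
   [kn b < a] makes it start at [1 - d] or above; the gap [1 - x] is [4 * d]. *)
pose d := (1 - x) / 4.
have d1 : 0 < d < 1 by rewrite /d; lra.
have dE : d * 4 = 1 - x by rewrite /d; lra.
clearbody d.
pose b := g - d * (g - 1) / 2.
have b1 : 1 < b by rewrite /b; nra.
have bg : b < g by rewrite /b; nra.
have [y yB] := bounded_orb_ex b1 aA.
have dist n := orb_base_dist n b1 wx yB.
have bd : `|g - b| / (b - 1) <= d.
  rewrite ler_pdivrMr; last lra.
  have dg : 0 < d * (g - 1) by rewrite mulr_gt0; lra.
  have dg2 : d * (d * (g - 1)) <= d * (g - 1) by rewrite ler_piMl; lra.
  have -> : g - b = d * (g - 1) / 2 by rewrite /b; ring.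
  by rewrite ger0_norm /b; lra.
have dist' n : orb g a x n - d <= orb b a y n <= orb g a x n + d.
  by have := le_trans (dist n) bd; rewrite ler_norml; lra.
have y_ge : 1 - d <= y.
  suff [i h] : exists i, - d <= b ^+ i.+1 * (y - 1).
    rewrite leNgt; apply/negP => yd.
    have := @ler_wnM2r _ (y - 1) ltac:(lra) _ _ (exprn_ege1 i.+1 (ltW b1)).
    by lra.
  case: (alt_cut R (below b b1 bg)) => i m _ _ _ /(_ b 1 y) e; exists i;
  rewrite e; have := kn_weak b i.+1; have := dist' i.+1; have := wx i.+1;
  by have := ler0n R m; lra.
by have /= := dist' 0%N; lra.
Qed.

End Existence.

(** * Concatenations of two blocks *)

Section Blocks.
Implicit Types (a t : zseq) (v w c : word) (k m n : nat).

Lemma mkseq_add a m n : mkseq a (m + n) = mkseq a m ++ mkseq (shift m a) n.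
Proof.
rewrite /mkseq iotaD map_cat; congr (_ ++ _).
by rewrite add0n -[m in iota m](addn0 m) iotaDl -map_comp.
Qed.

Lemma flatten_mkseqS (c : nat -> word) n :
  flatten (mkseq c n.+1) = flatten (mkseq c n) ++ c n.
Proof. by rewrite mkseqS flatten_rcons. Qed.

(** [Q] is an invariant that survives the removal of a first block; choice then produces the whole
    sequence of blocks. *)
Lemma omega2_intro (Q : zseq -> Prop) v w a :
  (forall t, Q t -> exists c,
     [/\ c = v \/ c = w, mkseq t (size c) = c & Q (shift (size c) t)]) ->
  Q a -> omega2 v w a.
Proof.
move=> QS Qa.
have ex t : exists c, Q t ->
    [/\ c = v \/ c = w, mkseq t (size c) = c & Q (shift (size c) t)].
  by have [/QS[c hc]|nQ] := pselect (Q t); [exists c|exists [::]].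
have [f fP] := choice ex.
pose st n := iter n (fun t => shift (size (f t)) t) a.
have Qst n : Q (st n) by elim: n => //= n /fP[].
exists (fun n => f (st n)); split => [i|n]; first by case: (fP _ (Qst i)).
pose p n := flatten (mkseq (fun n => f (st n)) n).
suff [] : mkseq a (size (p n)) = p n /\ st n = shift (size (p n)) a by [].
elim: n => [//|n [IH1 IH2]]; rewrite /p flatten_mkseqS -/(p n) size_cat.
rewrite mkseq_add IH1 -IH2; split; first by case: (fP _ (Qst n)) => _ ->.
by rewrite /st iterS -/(st n) {2}IH2 shiftD.
Qed.

Lemma omega2_elim v w a : omega2 v w a -> exists c : nat -> word,
  (forall i, c i = v \/ c i = w) /\ forall n,
    mkseq (shift (size (flatten (mkseq c n))) a) (size (c n)) = c n.
Proof.
case=> c [cvw cP]; exists c; split => // n.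
have cP' m : mkseq a (size (flatten (mkseq c m))) = flatten (mkseq c m) := cP m.
have := cP' n.+1; rewrite flatten_mkseqS size_cat mkseq_add cP' => /eqP.
by rewrite eqseq_cat // eqxx => /eqP.
Qed.

Lemma mkseq_eqP a t n :
  mkseq a n = mkseq t n <-> forall i, (i < n)%N -> a i = t i.
Proof.
split=> [e i ni|e].
  by rewrite -(nth_mkseq 0 a ni) e nth_mkseq.
by apply/eq_in_map => i; rewrite mem_iota => /andP[_]; apply: e.
Qed.

Lemma shift_periodic v : shift (size v) (periodic v) = periodic v.
Proof. by apply/funext => n; rewrite /shift /periodic modnDl. Qed.

Lemma periodic_nth v n : (n < size v)%N -> periodic v n = nth 0 v n.
Proof. by move=> nv; rewrite /periodic modn_small. Qed.

Lemma periodic_eq v a : (0 < size v)%N -> 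
  (forall n, mkseq (shift (n * size v) a) (size v) = v) -> a = periodic v.
Proof.
move=> v0 h; apply/funext => n; rewrite /periodic -{1}(h (n %/ size v)%N).
by rewrite nth_mkseq ?ltn_mod // /shift -divn_eq.
Qed.

End Blocks.

(** With [N = a k] the loop and the detour are the blocks of (3), with [N = a k + 1] those of (4).
    If [N] leads to [1], then [N - 1] leads to [0], from where the digit [0] leads to [1]. *)
Definition loop_word (a : zseq) (k : nat) (N : int) : word :=
  rcons (mkseq a k) N.

Definition detour_word (a : zseq) (k : nat) (N : int) : word :=
  rcons (rcons (mkseq a k) (N - 1)) 0.

(** * Orbits along the loop and the detour *)

Section LoopBlocks.
Variable R : realType.
Implicit Types (b x y : R) (a t : zseq) (k n : nat) (N : int).

Lemma size_loop_word a k N : size (loop_word a k N) = k.+1.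
Proof. by rewrite size_rcons size_mkseq. Qed.

Lemma size_detour_word a k N : size (detour_word a k N) = k.+2.
Proof. by rewrite !size_rcons size_mkseq. Qed.

Lemma mkseq_loop_word t a k N : mkseq t k.+1 = loop_word a k N <->
  mkseq t k = mkseq a k /\ t k = N.
Proof. by rewrite mkseqS; split=> [/rcons_inj[]|[-> ->]]. Qed.

Lemma mkseq_detour_word t a k N : mkseq t k.+2 = detour_word a k N <->
  [/\ mkseq t k = mkseq a k, t k = N - 1 & t k.+1 = 0].
Proof.
rewrite mkseqS mkseqS /detour_word.
by split=> [/rcons_inj[/rcons_inj[]]|[-> -> ->]].
Qed.

Lemma orb_block b a t y k : mkseq t k = mkseq a k ->
  orb b t y k = orb b a 1 k + (- b) ^+ k * (y - 1).
Proof.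
by move=> /mkseq_eqP/eq_orb ->; rewrite -(orb_sub b a 1 y) addrC subrK.
Qed.

Lemma orb_loop_word b a t y k N : mkseq t k.+1 = loop_word a k N ->
  orb b t y k.+1 = N%:~R + 1 - b * orb b a 1 k + (- b) ^+ k.+1 * (y - 1).
Proof.
move=> /mkseq_loop_word[/orb_block tk tN] /=; rewrite tk tN exprS; ring.
Qed.

Lemma orb_detour_word b a t y k N : mkseq t k.+2 = detour_word a k N ->
  orb b t y k.+1 = N%:~R - b * orb b a 1 k + (- b) ^+ k.+1 * (y - 1) /\
  orb b t y k.+2 = 1 - b * orb b t y k.+1.
Proof.
move=> /mkseq_detour_word[/orb_block tk tN t0]; split; last by rewrite /= t0 add0r.
by rewrite /= tk tN intrB exprS; ring.
Qed.

Lemma eq_int_of_close (m n : int) (x y z : R) :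
  m%:~R - z = x -> n%:~R - z = y -> 0 < x < 1 -> 0 <= y <= 1 -> m = n.
Proof.
move=> ex ey hx hy; apply/eqP; rewrite eq_le -!ltzD1 -!(ltr_int R) !intrD.
by apply/andP; split; lra.
Qed.

Section FirstReturn.
Variables (b : R) (a : zseq) (k : nat) (N : int).
Hypotheses
  (inner : forall j, (0 < j <= k)%N -> 0 < orb b a 1 j < 1)
  (loop1 : N%:~R + 1 - b * orb b a 1 k = 1).

(** As long as the reference orbit is strictly inside the interval, any other digit would leave even
    the closed interval. *)
Lemma weak_prefix t : weak b t 1 -> mkseq t k = mkseq a k.
Proof.
move=> wt; apply/mkseq_eqP.
suff h m : (m <= k)%N -> forall i, (i < m)%N -> t i = a i by exact: (h k).
elim: m => // m IH mk i; rewrite ltnS leq_eqVlt => /predU1P[->{i}|]; last first.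
  by apply: IH; rewrite ltnW.
have e := eq_orb b 1 (IH (ltnW mk)).
symmetry; apply: (@eq_int_of_close _ _ (orb b a 1 m.+1) (orb b t 1 m.+1)
  (b * orb b a 1 m - 1)) => //.
- by rewrite /=; ring.
- by rewrite /= e; ring.
- exact: inner.
Qed.

(** At time [k] only [N] and [N - 1] stay in [[0, 1]]. After [N - 1] the orbit is at [0], where [0]
    is the only nonnegative digit that stays inside. *)
Lemma weak_first_block t : (forall n, 0 <= t n) -> weak b t 1 ->
  exists c, [/\ c = loop_word a k N \/ c = detour_word a k N,
    mkseq t (size c) = c & weak b (shift (size c) t) 1].
Proof.
move=> t0 wt; have tk := weak_prefix wt.
have tN : orb b t 1 k.+1 = 1 + (t k - N)%:~R.
  by rewrite /= (orb_block b 1 tk) subrr mulr0 addr0 intrB; have := loop1; lra.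
have [e|ne] := eqVneq (t k) N.
  exists (loop_word a k N); rewrite size_loop_word; split; first by left.
    exact/mkseq_loop_word.
  have := weak_shift k.+1 wt.
  by rewrite tN e subrr addr0.
have e : t k = N - 1.
  have /andP[h1 h2] := wt k.+1; rewrite tN in h1 h2.
  have h3 : 0 <= t k - N + 1 by rewrite -(ler_int R) intrD; lra.
  have h4 : t k - N <= 0 by rewrite -(ler_int R); lra.
  by lia.
have o0 : orb b t 1 k.+1 = 0 by rewrite tN e addrAC subrr add0r intrN; lra.
have o1 : orb b t 1 k.+2 = (t k.+1)%:~R + 1.
  by rewrite -[LHS]/(_ - b * orb b t 1 k.+1) o0 mulr0 subr0.
have tk1 : t k.+1 = 0.
  apply/eqP; rewrite eq_le t0 andbT -(ler_int R).
  by have := wt k.+2; rewrite o1; lra.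
exists (detour_word a k N); rewrite size_detour_word; split; first by right.
  exact/mkseq_detour_word.
have := weak_shift k.+2 wt.
by rewrite o1 tk1 add0r.
Qed.

Lemma weak_omega2 t : (forall n, 0 <= t n) -> weak b t 1 ->
  omega2 (loop_word a k N) (detour_word a k N) t.
Proof.
move=> t0 wt.
apply: (@omega2_intro (fun t => (forall n, 0 <= t n) /\ weak b t 1)) => //.
move=> s [s0 /(weak_first_block s0)[c [cvw sc ws]]].
by exists c; split => //; split => // n; apply: s0.
Qed.

(** Through [kn_gt_u], this provides the guards [u < vvv...] of (3) and (4). *)
Lemma loop_periodic_kn : periodic (loop_word a k N) = kn b.
Proof.
set v := loop_word a k N; have sv : size v = k.+1 := size_loop_word a k N.
have ev : mkseq (periodic v) k.+1 = v.
  rewrite -[RHS](mkseq_nth 0) sv; apply/mkseq_eqP => i ik.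
  by rewrite periodic_nth ?sv.
have /mkseq_loop_word[/mkseq_eqP/eq_orb ek _] := ev.
have ret : orb b (periodic v) 1 k.+1 = 1.
  by rewrite (orb_loop_word b 1 ev) subrr mulr0 addr0.
apply: itin_eqP; elim/ltn_ind => n IH.
have [nk|kn] := leqP n k.
  have -> : orb b (periodic v) 1 n = orb b a 1 n.
    have /mkseq_loop_word[/mkseq_eqP e _] := ev.
    by apply: eq_orb => i /leq_trans/(_ nk); apply: e.
  case: n nk {IH} => [|n] nk; first by rewrite /= ltr01 lexx.
  by have := inner (j := n.+1) nk; lra.
rewrite -(subnKC kn) orbD ret -sv shift_periodic; apply: IH.
by rewrite sv; lia.
Qed.

End FirstReturn.
End LoopBlocks.

Lemma omega2C v w : omega2 v w = omega2 w v.
Proof.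
by apply/seteqP; split=> a [c [cvw cP]]; exists c; split=> // i;
  case: (cvw i); [right|left|right|left].
Qed.

Lemma loop_word_self a k : loop_word a k (a k) = mkseq a k.+1.
Proof. by rewrite mkseqS. Qed.

Lemma detour_word_succ a k : detour_word a k (a k + 1) = rcons (mkseq a k.+1) 0.
Proof. by rewrite /detour_word addrK mkseqS. Qed.

(** * Conditions (3) and (4) *)

Section Conditions.
Variable R : realType.
Implicit Types (b x y : R) (a t : zseq) (k n : nat) (N : int).

Lemma weak_kn b a : 1 < b -> (forall n, 0 <= a n) -> weak b a 1 ->
  (forall k, alt_lt u (periodic (loop_word a k (a k))) ->
    omega2 (loop_word a k (a k)) (detour_word a k (a k)) a ->
    a = periodic (loop_word a k (a k))) ->
  (forall k, alt_lt u (periodic (loop_word a k (a k + 1))) ->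
    ~ omega2 (loop_word a k (a k + 1)) (detour_word a k (a k + 1)) a) ->
  a = kn b.
Proof.
move=> b1 a0 wa h3 h4; apply: itin_eqP => n; apply: contrapT => hn.
have on : orb b a 1 n = 0.
  have /andP[o0 o1] := wa n; apply/eqP; rewrite eq_le o0 andbT leNgt.
  by apply/negP => h; apply: hn; rewrite h.
case: n {hn} on => [/eqP|n on]; first by rewrite oner_eq0.
have [k] := ex_minnP (ex_intro
  (fun k => (orb b a 1 k.+1 == 0) || (orb b a 1 k.+1 == 1)) n
  (introT orP (or_introl (introT eqP on)))).
move=> ok kmin.
have inner j : (0 < j <= k)%N -> 0 < orb b a 1 j < 1.
  case: j => // j /= jk; have /andP[o0 o1] := wa j.+1.
  rewrite !lt_neqAle o0 o1 !andbT eq_sym.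
  rewrite -negb_or; apply/negP => /kmin; rewrite leqNgt.
  by rewrite jk.
(* A first visit at [0] becomes a return to [1] when the last digit is raised by one, which is the
   case of (4); a first visit at [1] is the case of (3). *)
case/orP: ok => /eqP ok.
- have loop1 : (a k + 1)%:~R + 1 - b * orb b a 1 k = 1.
    by move: ok; rewrite /= intrD; lra.
  have om := weak_omega2 inner loop1 a0 wa.
  apply: h4 om; rewrite (loop_periodic_kn inner loop1); exact: kn_gt_u.
- have loop1 : (a k)%:~R + 1 - b * orb b a 1 k = 1 := ok.
  have per := loop_periodic_kn inner loop1.
  have e : a = kn b.
    rewrite -per; apply: h3 (weak_omega2 inner loop1 a0 wa).
    by rewrite per; apply: kn_gt_u.
  have : 0 < orb b a 1 n.+1 <= 1 by rewrite e; apply: itin_orb; rewrite ltr01 lexx.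
  by rewrite on ltxx.
Qed.

(** [D n] is the distance to [1] at the start of block [n], and [e n] the point reached after
    [k + 1] letters of a detour. A loop ends at [1 + e n]; a detour needs [e n > 0]. *)
Lemma omega2_orbit b a k N : (forall n, 0 < orb b a 1 n <= 1) ->
  omega2 (loop_word a k N) (detour_word a k N) a ->
  exists D : nat -> R, let e n := N%:~R - b * orb b a 1 k - (- b) ^+ k.+1 * D n in
  [/\ D 0%N = 0, forall n, 0 <= D n < 1,
    forall n, D n.+1 = - e n \/ 0 < e n /\ D n.+1 = b * e n
  & (forall n, e n <= 0) -> a = periodic (loop_word a k N)].
Proof.
move=> oa /omega2_elim[c [cvw cP]].
pose pos n := size (flatten (mkseq c n)).
have posS n : pos n.+1 = (pos n + size (c n))%N.
  by rewrite /pos flatten_mkseqS size_cat.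
pose D n := 1 - orb b a 1 (pos n).
have step n : let e := N%:~R - b * orb b a 1 k - (- b) ^+ k.+1 * D n in
    c n = loop_word a k N /\ D n.+1 = - e \/ 0 < e /\ D n.+1 = b * e.
  have cn := cP n; rewrite -/(pos n) in cn.
  have Dn : D n.+1 = 1 - orb b (shift (pos n) a) (1 - D n) (size (c n)).
    by rewrite /D posS orbD subKr.
  case: (cvw n) => e; rewrite e ?size_loop_word ?size_detour_word in cn Dn.
  - left; split=> //; rewrite Dn (orb_loop_word b _ cn).
    by rewrite [1 - D n - 1]addrAC subrr add0r; ring.
  - right; have [e1 e2] := orb_detour_word b (1 - D n) cn.
    rewrite [1 - D n - 1]addrAC subrr add0r mulrN in e1.
    rewrite -e1; split; last by rewrite Dn e2; ring.
    have -> : 1 - D n = orb b a 1 (pos n) by rewrite /D; ring.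
    by rewrite -orbD; have /andP[] := oa (pos n + k.+1)%N.
exists D; split.
- by rewrite /D subrr.
- by move=> n; have := oa (pos n); rewrite /D; lra.
- by move=> n; case: (step n) => [[]|]; [left|right].
move=> e0.
have cv n : c n = loop_word a k N.
  by case: (step n) => [[]//|[]]; rewrite ltNge e0.
have posE n : pos n = (n * size (loop_word a k N))%N.
  by elim: n => // n IH; rewrite posS IH cv mulSn addnC.
apply: periodic_eq => [|n]; first by rewrite size_loop_word.
by rewrite -posE -(cv n); apply: cP.
Qed.

Lemma growth_false (D : nat -> R) (mu d : R) : 1 < mu -> 0 < d ->
  (forall n, D n < 1) -> d <= D 1%N ->
  (forall n, d <= D n -> mu * D n <= D n.+1) -> False.
Proof.
move=> mu1 d0 D1 dD DS.
suff h n : mu ^+ n * d <= D n.+1.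
  have : d <= 0 by apply: (@expr_bounded_le0 _ mu _ 1) => // n; apply: le_trans (h n) (ltW (D1 _)).
  by rewrite leNgt d0.
elim: n => [|n IH]; first by rewrite mul1r.
rewrite exprS -mulrA; apply: le_trans (DS _ _).
  by rewrite ler_pM2l //; lra.
by apply: le_trans IH; rewrite ler_peMl ?exprn_ege1 ?(ltW d0) ?(ltW mu1).
Qed.

(* When u starts with a word v of odd length and u < vvv..., the rest of u
   after v is > vvv... > u, against the maximality of u among its tails. *)
Lemma odd_loop_le_u k : odd k.+1 -> ~ alt_lt u (periodic (mkseq u k.+1)).
Proof.
move=> ok uv; set v := mkseq u k.+1 in uv.
have sv : size v = k.+1 by rewrite size_mkseq.
have [l hl] := alt_lt_prefix uv.
(* An itinerary following [u] replaces it, since the maximality among tails is known for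
   itineraries. *)
have [b [/andP[b1 _] bu]] := kn_prefix_u (l + k.+1) (ltr1n R 2).
have bv : alt_lt (kn b) (periodic v).
  by apply: hl => j jl; apply: bu; rewrite ltn_addr.
case: bv => i [bvi nbv lt].
have ki : (k < i)%N.
  rewrite ltnNge; apply/negP => ik; case/negP: nbv.
  rewrite periodic_nth ?sv // nth_mkseq // bu //.
  by rewrite (leq_trans _ (leq_addl _ _)).
have per j : periodic v (k.+1 + j)%N = periodic v j.
  by rewrite -[in LHS]sv -/(shift (size v) (periodic v) j) shift_periodic.
have [j ij] : exists j, i = (k.+1 + j)%N by exists (i - k.+1)%N; rewrite subnKC.
subst i.
have bj m : (m <= j)%N -> kn b m = periodic v m by move=> mj; apply: bvi; lia.
have : alt_le (shift k.+1 (kn b)) (kn b).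
  by apply: itin_shift_le; rewrite ?ltr01 ?lexx.
suff h : alt_lt (kn b) (shift k.+1 (kn b)).
  by move=> /alt_le_lt_trans/(_ h)/alt_ltxx.
exists j; split.
- by move=> m mj; rewrite bj ?(ltnW mj) // -per -bvi ?ltn_add2l.
- by rewrite eq_sym (bj j) // -per.
- move: lt; rewrite (bj j) // per /shift oddD ok.
  by case: (odd j).
Qed.

Lemma kn_eq_u_small b k : 1 < b -> b ^+ k.+2 <= b + 1 ->
  forall j, (j < k.+1)%N -> kn b j = u j.
Proof.
move=> b1 bk; apply: kn_eq_u => //.
have b0 : 0 < b by lra.
by rewrite -(ltr_pM2l b0) -exprS; lra.
Qed.

Lemma kn_cond3 b k : 1 < b ->
  alt_lt u (periodic (loop_word (kn b) k (kn b k))) ->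
  omega2 (loop_word (kn b) k (kn b k)) (detour_word (kn b) k (kn b k)) (kn b) ->
  kn b = periodic (loop_word (kn b) k (kn b k)).
Proof.
move=> b1 uv om; apply: contrapT => nper.
have oa : forall n, 0 < orb b (kn b) 1 n <= 1.
  by apply: itin_orb; rewrite ltr01 lexx.
have [D [D0 D01 DS per]] := omega2_orbit oa om.
set c0 := _%:~R - _ in DS per.
have c0E : c0 = orb b (kn b) 1 k.+1 - 1 by rewrite /c0 /=; ring.
have c00 : c0 <= 0 by rewrite c0E; have := oa k.+1; lra.
clearbody c0.
have bk0 : 0 < b ^+ k.+1 by rewrite exprn_gt0 //; lra.
have sgn n : (- b) ^+ k.+1 * D n = (if odd k.+1 then - 1 else 1) * (b ^+ k.+1 * D n).
  by rewrite exprNn -signr_odd; case: odd; rewrite ?expr0 ?expr1; ring.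
have BD n : 0 <= b ^+ k.+1 * D n.
  by apply: mulr_ge0; [exact: ltW|case/andP: (D01 n)].
(* For even length every [e n] is nonpositive, so no detour occurs. *)
have [ok|ek] := boolP (odd k.+1); last first.
  by apply: nper; apply: per => n; rewrite sgn (negPf ek) mul1r; have := BD n; lra.
have {sgn} sgn n : c0 - (- b) ^+ k.+1 * D n = c0 + b ^+ k.+1 * D n.
  by rewrite sgn ok; ring.
have D1 : D 1%N = - c0.
  by case: (DS 0%N) => [|[]]; rewrite sgn D0 mulr0 addr0; lra.
have c0lt : c0 < 0.
  rewrite lt_neqAle c00 andbT; apply/eqP => c0_0; apply: nper; apply: per.
  suff Dn n : D n = 0 by move=> n; rewrite sgn Dn c0_0 mulr0 addr0.
  elim: n => // n IH; case: (DS n) => [->|[]];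
    by rewrite sgn IH c0_0 mulr0 addr0 ?oppr0 ?ltxx.
have bk : b + 1 < b ^+ k.+2.
  rewrite ltNge; apply/negP => bk.
  case: (odd_loop_le_u ok); move: uv; rewrite loop_word_self.
  by have /mkseq_eqP -> := kn_eq_u_small b1 bk.
have bk1 : 1 < b ^+ k.+1 by rewrite exprn_egt1.
apply: (@growth_false D (b ^+ k.+2 - b) (- c0)) => //.
- lra.
- lra.
- by move=> n; have /andP[] := D01 n.
- by rewrite D1.
(* From a distance of at least [- c0] a loop would overshoot [1], so the block is a detour. *)
move=> n dD; rewrite exprS; have := D01 n.+1.
have h : D n < b ^+ k.+1 * D n by rewrite ltr_pMl //; lra.
case: (DS n) => [->|[_ ->]]; rewrite sgn; first lra.
move=> _.
have : b * (- c0) <= b * D n by rewrite ler_pM2l //; lra.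
by lra.
Qed.

Lemma kn_cond4 b k : 1 < b ->
  alt_lt u (periodic (loop_word (kn b) k (kn b k + 1))) ->
  ~ omega2 (loop_word (kn b) k (kn b k + 1))
      (detour_word (kn b) k (kn b k + 1)) (kn b).
Proof.
move=> b1 uv om.
have oa : forall n, 0 < orb b (kn b) 1 n <= 1.
  by apply: itin_orb; rewrite ltr01 lexx.
have [D [D0 D01 DS _]] := omega2_orbit oa om.
set c0 := _%:~R - _ in DS.
have c0E : c0 = orb b (kn b) 1 k.+1 by rewrite /c0 /= intrD; ring.
have c00 : 0 < c0 by rewrite c0E; have /andP[] := oa k.+1.
clearbody c0.
have b0 : 0 < b by lra.
have bk0 : 0 < b ^+ k.+1 by rewrite exprn_gt0.
have bc0 : 0 < b * c0 by rewrite mulr_gt0.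
have bk1 : 1 < b ^+ k.+1 by rewrite exprn_egt1.
have sgn n : (- b) ^+ k.+1 * D n = (if odd k.+1 then - 1 else 1) * (b ^+ k.+1 * D n).
  by rewrite exprNn -signr_odd; case: odd; rewrite ?expr0 ?expr1; ring.
have D1 : D 1%N = b * c0.
  by case: (DS 0%N) => [|[_]]; rewrite D0 mulr0 subr0 //; have := D01 1%N; lra.
have Dlt n : D n < 1 by have /andP[] := D01 n.
have [ok|ek] := boolP (odd k.+1).
- apply: (@growth_false D b (b * c0)) => //; first by rewrite D1.
  move=> n dD.
  have h : D n < b ^+ k.+1 * D n by rewrite ltr_pMl //; lra.
  have := D01 n.+1; case: (DS n) => [->|[_ ->]]; rewrite sgn ok; first lra.
  by move=> _; rewrite ler_pM2l //; lra.
- have bk : b + 1 < b ^+ k.+2.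
    rewrite ltNge; apply/negP => bk.
    have kn_u := kn_eq_u_small b1 bk.
    (* The period is a prefix of [u] with its last letter raised at an odd index, where larger
       letters make sequences smaller. *)
    apply: (alt_lt_asym uv).
    have e : forall i, (i <= k)%N -> periodic (loop_word (kn b) k (kn b k + 1)) i =
        if i == k then u k + 1 else u i.
      move=> i ik; rewrite periodic_nth ?size_loop_word // nth_rcons size_mkseq.
      rewrite (ltn_neqAle i k) ik andbT.
      case: eqP => [_|/eqP nik] /=; first by rewrite kn_u.
      by rewrite nth_mkseq ?kn_u // ltn_neqAle nik.
    exists k; rewrite e // eqxx.
    have -> : odd k by move: ek => /=; rewrite negbK.
    split=> [i ik||]; rewrite ?gt_eqF ?ltrDl //.
    by rewrite e ?(ltnW ik) // ltn_eqF.
  rewrite exprS in bk.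
  have mu1 : 1 < b ^+ k.+1 - b^-1.
    by rewrite -(ltr_pM2l b0) mulrBr divff ?gt_eqF //; lra.
  apply: (@growth_false D (b ^+ k.+1 - b^-1) (b * c0)) => //; first by rewrite D1.
  (* [b * c0 <= D n] rules out a detour, and a loop gives [b ^ k.+1 * D n - c0]. *)
  move=> n dD.
  have h : c0 <= b^-1 * D n by rewrite -(ler_pM2l b0) mulVKf ?gt_eqF.
  have h' : 0 <= (b ^+ k.+1 - b^-1 - 1) * D n by rewrite mulr_ge0 //; lra.
  have := D01 n.+1.
  by case: (DS n) => [->|[+ _]]; rewrite sgn (negPf ek) mul1r; lra.
Qed.

End Conditions.

(** * Characterization of the expansions and uniqueness of the base *)

Unset Implicit Arguments.

Theorem theorem2 (R : realType) (a : zseq) (ha : forall n, 0 <= a n) :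
  ((exists beta : R, 1 < beta /\ a = expansion beta (- beta / (beta + 1)))
   <->
   [/\ forall k, (2 <= k)%N -> alt_le (tail_from a k) a,
       alt_lt u a,
       forall k, (1 <= k)%N -> alt_lt u (periodic (mkseq a k)) ->
         ~ (omega2 (mkseq a k) (rcons (change_last a k (-1)) 0)
            `\` [set periodic (mkseq a k)]) a
     & forall k, (1 <= k)%N -> alt_lt u (periodic (change_last a k 1)) ->
         ~ omega2 (rcons (mkseq a k) 0) (change_last a k 1) a])
  /\
  (forall beta gamma : R,
     1 < beta -> a = expansion beta (- beta / (beta + 1)) ->
     1 < gamma -> a = expansion gamma (- gamma / (gamma + 1)) ->
     beta = gamma).
Proof.
split; last first.
  move=> b g b1 ab g1; rewrite {}ab !expansionE // => e.
  by case: (ltgtP b g) => // [/(kn_lt b1)|/(kn_lt g1)]; rewrite e => /alt_ltxx.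
split=> [[b [b1 ->]]|[h1 h2 h3 h4]].
  rewrite expansionE //; split.
  - move=> [//|k] _; apply: (@itin_shift_le R b 1 k b1).
    by rewrite ltr01 lexx.
  - exact: kn_gt_u.
  - move=> [//|k] _; rewrite -loop_word_self => uv [om nper]; apply: nper.
    exact: kn_cond3.
  - move=> [//|k] _ uv; rewrite -detour_word_succ omega2C.
    exact: kn_cond4.
(* [tail_from] counts from 1: the shift by [n + 1] is the tail from index [n + 2]. *)
have tails n : alt_le (shift n a) a by case: n => [|n]; [right|exact: (h1 n.+2)].
have [b b1 wa] := weak_base_ex R ha tails h2.
exists b; split=> //; rewrite expansionE //; apply: weak_kn => //.
- move=> k; rewrite loop_word_self => uv om; apply: contrapT => nper.
  by apply: (h3 k.+1 isT uv); split.
- move=> k uv om; apply: (h4 k.+1 isT uv).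
  by rewrite -detour_word_succ omega2C.
Qed.
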